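(* Suppose that for every $(\theta,s)\in\Theta\times\{0,1,\dots,S\}$ the equation $\Phi_n(\theta,u_s,\pi)=0$ has a unique solution $\pi\in\Pi$. Suppose also that (i) $\hat\pi_n=x$, where $x$ is the observed sample, and (ii) $\hat\pi^{(s)}_{\mathrm{II},n}(\theta)=g(\theta,u_s)$ for all $\theta\in\Theta$ and $s\in\{1,\dots,S\}$. Then, for every $s\in\{1,\dots,S\}$, $$\Theta^{(s)}_{n}=\Theta^{(s)}_{\mathrm{GFD},n}.$$
   Context: Setting: $\Theta,\Pi\subset\mathbb{R}^p$ are parameter sets. Data are generated as $x=g(\theta,u)$, where $u$ follows a known distribution $F_u$ not depending on $\theta$. For an estimating function $\psi$ with values in $\mathbb{R}^p$, put $\Phi_n(\theta,u,\pi)=\frac1n\sum_{i=1}^n\psi(g(\theta,u_{i}),\pi)$. $\theta_0\in\Theta$ is the true parameter, $u_0$ is the realization of $u$ that generated the observed sample $x=g(\theta_0,u_0)$, and $u_1,\dots,u_S$ are simulated realizations of $u$. $\operatorname{argzero}$ denotes the set of all zeros; $d$ is a metric. Auxiliary estimator: $\hat\pi_n\in\operatorname{argzero}_{\pi\in\Pi}\Phi_n(\theta_0,u_0,\pi)$. SwiZs: $\Theta_n^{(s)}=\operatorname{argzero}_{\theta\in\Theta}\Phi_n(\theta,u_s,\hat\pi_n)$. Simulated auxiliary estimator: $\hat\pi^{(s)}_{\mathrm{II},n}(\theta)\in\operatorname{argzero}_{\pi\in\Pi}\Phi_n(\theta,u_s,\pi)$ for $\theta\in\Theta$. Generalized fiducial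 inference: $\Theta^{(s)}_{\mathrm{GFD},n}=\operatorname{argzero}_{\theta\in\Theta}d\big(x,g(\theta,u_s)\big)$. *)

(* Defs.v *)
From HB Require Import structures.
From mathcomp Require Import all_boot all_order all_algebra.
From mathcomp Require Import classical_sets reals.

Set Implicit Arguments.
Unset Strict Implicit.
Unset Printing Implicit Defensive.

Import Order.TTheory GRing.Theory Num.Theory.
Local Open Scope classical_set_scope.
Local Open Scope ring_scope.

Definition argzero (T : Type) (V : zmodType) (A : set T) (f : T -> V) : set T :=
  [set t | A t /\ f t = 0].

(* A predicate rather than a [metricType]: the distance on samples is an
   arbitrary one, unrelated to the canonical topology of matrices. *)
Record is_metric (R : realType) (T : Type) (d : T -> T -> R) : Prop := IsMetric {
  is_metric_refl : forall x, d x x = 0;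
  is_metric_eq0 : forall x y, d x y = 0 -> x = y;
  is_metric_sym : forall x y, d x y = d y x;
  is_metric_triangle : forall x y z, d x z <= d x y + d y z
}.

Section Estimators.
Variables (R : realType) (p q n : nat) (U : Type).

(* [g theta w] is a single observation in R^q; a realization of u is a family
   of n inputs w in U, and observation i of the sample is row i. *)
Definition sample (g : 'rV[R]_p -> U -> 'rV[R]_q)
    (theta : 'rV[R]_p) (u : 'I_n -> U) : 'M[R]_(n, q) :=
  \matrix_(i < n) g theta (u i).

Definition Phi (psi : 'rV[R]_q -> 'rV[R]_p -> 'rV[R]_p)
    (g : 'rV[R]_p -> U -> 'rV[R]_q)
    (theta : 'rV[R]_p) (u : 'I_n -> U) (pi : 'rV[R]_p) : 'rV[R]_p :=
  n%:R^-1 *: \sum_(i < n) psi (g theta (u i)) pi.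

Definition swizs (Theta : set 'rV[R]_p)
    (psi : 'rV[R]_q -> 'rV[R]_p -> 'rV[R]_p) (g : 'rV[R]_p -> U -> 'rV[R]_q)
    (u : 'I_n -> U) (pihat : 'rV[R]_p) : set 'rV[R]_p :=
  argzero Theta (fun theta => Phi psi g theta u pihat).

Definition gfd (Theta : set 'rV[R]_p) (d : 'M[R]_(n, q) -> 'M[R]_(n, q) -> R)
    (g : 'rV[R]_p -> U -> 'rV[R]_q)
    (x : 'M[R]_(n, q)) (u : 'I_n -> U) : set 'rV[R]_p :=
  argzero Theta (fun theta => d x (sample g theta u)).

End Estimators.

(* Main.v *)
Require Import Defs.
From HB Require Import structures.
From mathcomp Require Import all_boot all_order all_algebra.
From mathcomp Require Import classical_sets reals.

Import Order.TTheory GRing.Theory Num.Theory.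
Local Open Scope classical_set_scope.
Local Open Scope ring_scope.

(* The hypotheses [pihat = x] and [piII s theta = g(theta, u_s)] identify a
   sample of n observations in R^q with a point of R^p; hence p is n * q and
   the identification is the row-by-row flattening [mxvec]. *)
Theorem proposition17 (R : realType) (n q S : nat) (n_gt0 : (0 < n)%N)
    (U : Type)
    (Theta Pi : set 'rV[R]_(n * q))
    (g : 'rV[R]_(n * q) -> U -> 'rV[R]_q)
    (psi : 'rV[R]_q -> 'rV[R]_(n * q) -> 'rV[R]_(n * q))
    (d : 'M[R]_(n, q) -> 'M[R]_(n, q) -> R) (d_metric : is_metric d)
    (u : 'I_S.+1 -> 'I_n -> U)
    (theta0 : 'rV[R]_(n * q)) (theta0_in : Theta theta0)
    (x : 'M[R]_(n, q)) (x_def : x = sample g theta0 (u ord0))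
    (pihat : 'rV[R]_(n * q))
    (pihat_def : argzero Pi (Phi psi g theta0 (u ord0)) pihat)
    (piII : 'I_S.+1 -> 'rV[R]_(n * q) -> 'rV[R]_(n * q))
    (piII_def : forall (s : 'I_S.+1) (theta : 'rV[R]_(n * q)), (0 < s)%N ->
       Theta theta -> argzero Pi (Phi psi g theta (u s)) (piII s theta))
    (uniq_zero : forall (theta : 'rV[R]_(n * q)) (s : 'I_S.+1), Theta theta ->
       exists! pi, argzero Pi (Phi psi g theta (u s)) pi)
    (hyp_i : pihat = mxvec x)
    (hyp_ii : forall (s : 'I_S.+1) (theta : 'rV[R]_(n * q)), (0 < s)%N ->
       Theta theta -> piII s theta = mxvec (sample g theta (u s))) :
  forall s : 'I_S.+1, (0 < s)%N ->
    swizs Theta psi g (u s) pihat = gfd Theta d g x (u s).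
Proof.
move=> s s_gt0; apply/seteqP; split=> theta [Theta_theta].
- move=> Phi_pihat_eq0; split=> //.
  have [pi0 [_ pi0_uniq]] := uniq_zero theta s Theta_theta.
  (* Swap the roles of the arguments: the SwiZs equation in [theta] is also an equation in [pi],
     solved by [pihat]. Membership in [Pi] is inherited from the estimation at [theta0]. *)
  have pihat_zero : argzero Pi (Phi psi g theta (u s)) pihat.
    by split=> //; case: pihat_def.
  have pihatE : pihat = piII s theta.
    by rewrite -(pi0_uniq _ pihat_zero) -(pi0_uniq _ (piII_def _ _ s_gt0 _)).
  (* Both sides of [pihatE] are flattened samples, and [mxvec] is injective. *)
  have -> : x = sample g theta (u s).
    by apply: (can_inj mxvecK); rewrite -hyp_i pihatE hyp_ii.
  exact: is_metric_refl d_metric _.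
(* Conversely, zero distance makes the observed and simulated samples equal, so [pihat] coincides
   with [piII s theta], which is a zero by its definition. *)
- move=> /(is_metric_eq0 d_metric) xE; split=> //.
  have [_] := piII_def s theta s_gt0 Theta_theta.
  by rewrite hyp_ii // -xE -hyp_i.
Qed.
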